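(* Consider the closed-loop nonlinear differential-algebraic system (NDAE) $$E_d\dot{\check x}_d=(A_d+B_dK_d)\check x_d+G_d\,\check f_d(\check x_d,\check x_a),\qquad 0=A_a\check x_a+G_a\,\check f_a(\check x_d,\check x_a),$$ with $\check x_d\in\mathcal X_d\subseteq\mathbb R^{n_d}$, $\check x_a\in\mathcal X_a\subseteq\mathbb R^{n_a}$ and a feedback gain $K_d\in\mathbb R^{n_u\times n_d}$, as described in the context, and suppose Assumptions 1 and 2 of the context hold. Suppose there exist a symmetric positive definite matrix $X_1\in\mathbb R^{n_d\times n_d}$, matrices $X_2\in\mathbb R^{n_a\times n_d}$, $R\in\mathbb R^{n_a\times n_a}$, $Y\in\mathbb R^{n_a\times n_d}$, $W\in\mathbb R^{n_u\times n_d}$, and a scalar $\bar\epsilon>0$ such that the linear matrix inequality $$\begin{bmatrix}\Psi & * & * & *\\ A_aX_2E_d^\top+A_aY & \Theta & * & *\\ \bar H_d^{1/2}X_1E_d^\top & O & -\bar\epsilon I & *\\ \bar H_a^{1/2}X_2E_d^\top+\bar H_a^{1/2}Y & \bar H_a^{1/2}R & O & -\bar\epsilon I\end{bmatrix}\prec 0$$ holds, where $$\Psi:=E_dX_1A_d^\top+A_dX_1E_d^\top+E_dW^\top B_d^\top+B_dWE_d^\top+\bar\epsilon\, G_dG_d^\top,$$ $$\Theta:=R^\top A_a^\top+A_aR+\bar\epsilon\, G_aG_a^\top,$$ $$\bar H_d:=(H_d^d)^\top H_d^d+(H_d^a)^\top H_d^a,\qquad \bar H_a:=(H_a^d)^\top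 H_a^d+(H_a^a)^\top H_a^a .$$ Then, with the controller gain $K_d=WX_1^{-1}$, the closed-loop system is asymptotically stable around the origin, i.e. $\lim_{t\to\infty}\|\check x_d(t)\|_2=0$ and $\lim_{t\to\infty}\|\check x_a(t)\|_2=0$.
   Context: Setting. $E_d,A_d\in\mathbb R^{n_d\times n_d}$, $A_a\in\mathbb R^{n_a\times n_a}$, $G_d\in\mathbb R^{n_d\times n_{fd}}$, $G_a\in\mathbb R^{n_a\times n_{fa}}$, $B_d\in\mathbb R^{n_d\times n_u}$ are constant real matrices. The vectors $\check x_d=x_d-x_d^e$ and $\check x_a=x_a-x_a^e$ are the deviations of the dynamic and algebraic states from a fixed equilibrium $x^e=(x_d^e,x_a^e)$, and the nonlinearities are $\check f_d(\check x_d,\check x_a)=f_d(x_d,x_a)-f_d(x_d^e,x_a^e)\in\mathbb R^{n_{fd}}$ and $\check f_a(\check x_d,\check x_a)=f_a(x_d,x_a)-f_a(x_d^e,x_a^e)\in\mathbb R^{n_{fa}}$, regarded as functions on $\mathbb R^{n_d}\times\mathbb R^{n_a}$. The sets $\mathcal X_d$, $\mathcal X_a$ (operating regions) are assumed to contain the solution manifold of the NDAE, i.e. solutions $(\check x_d(t),\check x_a(t))$, $t\ge t_0$, take values in $\mathcal X_d\times\mathcal X_a$. Assumption 1. (i) $\check f_d$ and $\check f_a$ are smooth with $\check f_d(0,0)=0$, $\check f_a(0,0)=0$. (ii) There are known constant real matrices $H_d^d,H_d^a$ (with $n_d$ columns) and $H_a^d,H_a^a$ (with $n_a$ columns) such that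 for all $\check x_d\in\mathcal X_d$, $\check x_a\in\mathcal X_a$, $$\|\check f_d(\check x_d,\check x_a)\|_2^2\le\|H_d^d\check x_d\|_2^2+\|H_a^d\check x_a\|_2^2,\qquad \|\check f_a(\check x_d,\check x_a)\|_2^2\le\|H_d^a\check x_d\|_2^2+\|H_a^a\check x_a\|_2^2 .$$ Assumption 2 (index one). For all $\check x_d\in\mathcal X_d$, $\check x_a\in\mathcal X_a$, $\operatorname{rank}\!\left(A_a+G_a\,\dfrac{\partial\check f_a}{\partial\check x_a}(\check x_d,\check x_a)\right)=n_a$. Definition. The NDAE is called asymptotically stable (around the origin) if $\lim_{t\to\infty}\|\check x_d(t)\|_2=0$ and $\lim_{t\to\infty}\|\check x_a(t)\|_2=0$ along its solutions. Notation. $*$ denotes the entries determined by symmetry of a symmetric block matrix; $I$ and $O$ are identity and zero matrices of appropriate sizes; $\prec 0$ means (symmetric) negative definite; $\bar H^{1/2}$ is the symmetric positive semidefinite square root. *)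

(* Defs.v *)
From HB Require Import structures.
From mathcomp Require Import all_boot all_order all_algebra.
From mathcomp Require Import all_classical all_reals all_analysis.
From mathcomp Require Import complex.

Set Implicit Arguments.
Unset Strict Implicit.
Unset Printing Implicit Defensive.

Import Order.TTheory GRing.Theory Num.Theory.
Import numFieldNormedType.Exports.

Local Open Scope ring_scope.
Local Open Scope classical_set_scope.

(* The norm provided by the library on matrices is the sup norm; it induces
   the topology used below, but the inequalities are about this one. *)
Definition norm2 (R : realType) (n : nat) (x : 'cV[R]_n) : R :=
  Num.sqrt (\sum_(i < n) x i 0 ^+ 2).

Definition posdefmx (R : realType) (n : nat) (M : 'M[R]_n) : Prop :=
  M^T = M /\ forall x : 'cV[R]_n, x != 0 -> 0 < (x^T *m M *m x) 0 0.

Definition negdefmx (R : realType) (n : nat) (M : 'M[R]_n) : Prop :=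
  M^T = M /\ forall x : 'cV[R]_n, x != 0 -> (x^T *m M *m x) 0 0 < 0.

Definition possemidefmx (R : realType) (n : nat) (M : 'M[R]_n) : Prop :=
  M^T = M /\ forall x : 'cV[R]_n, 0 <= (x^T *m M *m x) 0 0.

(* For H symmetric positive semidefinite such an S exists (psd_sqrtmxP) and is
   unique, so the choice made by xget is irrelevant. *)
Definition psd_sqrtmx (R : realType) (n : nat) (H : 'M[R]_n) : 'M[R]_n :=
  xget 0 [set S : 'M[R]_n | possemidefmx S /\ S *m S = H].

Lemma interpolation (F : fieldType) (s : seq F) (f : F -> F) :
  exists p : {poly F}, forall x, x \in s -> p.[x] = f x.
Proof.
elim: s => [|y s [p IH]]; first by exists 0.
have [ys|ys] := boolP (y \in s).
  by exists p => x; rewrite inE => /orP[/eqP ->|]; exact: IH.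
pose q := \prod_(z <- s) ('X - z%:P).
have qy : q.[y] != 0 by move: ys; rewrite -root_prod_XsubC.
exists (p + ((f y - p.[y]) / q.[y])%:P * q) => x; rewrite inE !hornerE.
case/orP => [/eqP ->|xs]; first by rewrite divfK // addrC subrK.
have -> : q.[x] = 0 by apply/eqP; move: xs; rewrite -root_prod_XsubC.
by rewrite mulr0 addr0 IH.
Qed.

Lemma quad_sum (R : realType) n (x : 'cV[R]_n) :
  (x^T *m x) 0 0 = \sum_i x i 0 ^+ 2.
Proof. by rewrite !mxE; apply: eq_bigr => i _; rewrite !mxE expr2. Qed.

Lemma psd_sqrtmxP (R : realType) (n : nat) (H : 'M[R]_n) :
  possemidefmx H ->
  possemidefmx (psd_sqrtmx H) /\ psd_sqrtmx H *m psd_sqrtmx H = H.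
Proof.
move=> [Hsym Hpos]; apply: (@xgetPex _ 0 (fun S => possemidefmx S /\ S *m S = H)).
case: n H Hsym Hpos => [|n] H Hsym Hpos.
  exists 0; split; last by rewrite [RHS]flatmx0 mulmx0.
  split; first by rewrite trmx0.
  by move=> x; rewrite mulmx0 mul0mx mxE.
pose f := @real_complex R.
pose A := map_mx f H.
have Aherm : A \is hermsymmx.
  apply/is_hermitianmxP; rewrite expr0 scale1r -map_trmx.
  apply/matrixP => i j; rewrite !mxE -[in LHS]Hsym mxE.
  by apply/esym/CrealP; rewrite complex_real.
have /orthomx_spectralP Aeq := hermitian_normalmx Aherm.
have dreal := hermitian_spectral_diag_real Aherm.
set P := spectralmx A in Aeq; set d := spectral_diag A in Aeq dreal.
have Punit : P \in unitmx := spectral_unit A.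
have dE j : exists2 r : R, d 0 j = f r & 0 <= r.
  have dj : d 0 j = f (complex.Re (d 0 j)).
    by rewrite /f RRe_real //; exact: (mxOverP dreal).
  exists (complex.Re (d 0 j)) => //.
  set r := complex.Re _ in dj *.
  have : eigenvalue A (d 0 j).
    apply/eigenvalueP; exists (row j P); last first.
      apply: contraTneq Punit => rj; rewrite -row_free_unit; apply/negP => /row_freeP [B PB].
      have : row j (P *m B) = 0 by rewrite row_mul rj mul0mx.
      rewrite PB => /rowP /(_ j); rewrite !mxE eqxx => /eqP.
      by rewrite oner_eq0.
    rewrite -row_mul {1}Aeq !mulmxA mulmxV // mul1mx mul_diag_mx.
    by apply/rowP => k; rewrite !mxE.
  rewrite dj eigenvalue_root_char -map_char_poly fmorph_root -eigenvalue_root_char.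
  case/eigenvalueP => v vH v0.
  have := Hpos v^T; rewrite trmxK vH -scalemxAl mxE.
  rewrite -{1}(trmxK v) quad_sum.
  rewrite pmulr_lge0 //.
  have [k vk] : exists k, v 0 k != 0.
    apply/existsP; apply: contraR v0; rewrite negb_exists => /forallP h.
    by apply/eqP/rowP => k; rewrite mxE; apply/eqP; rewrite -[_ == _]negbK; exact: h.
  rewrite (bigD1 k) //= ltr_pwDl //; first by rewrite mxE exprn_even_gt0.
  by apply: sumr_ge0 => i _; rewrite sqr_ge0.
have /choice [r rP] j : exists r : R, d 0 j = f r /\ 0 <= r.
  by have [x] := dE j; exists x.
have [p pE] := interpolation [seq r j | j <- enum 'I_n.+1]
  (fun x => Num.sqrt (Num.sqrt x)).
have pr j : p.[r j] = Num.sqrt (Num.sqrt (r j)).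
  by apply: pE; apply: map_f; rewrite mem_enum.
pose B := horner_mx H p.
have Bsym : B^T = B.
  rewrite /B; elim/poly_ind: p {pE pr B} => [|p c IH].
    by rewrite rmorph0 trmx0.
  rewrite rmorphD rmorphM /= horner_mx_X horner_mx_C raddfD /= tr_scalar_mx.
  congr (_ + _); rewrite -mulmxE trmx_mul Hsym IH.
  exact: (comm_mx_horner p (comm_mx_refl H)).
exists (B *m B); split; first split.
- by rewrite trmx_mul Bsym.
- move=> x; rewrite mulmxA -{1}Bsym -trmx_mul -mulmxA quad_sum.
  by apply: sumr_ge0 => i _; rewrite sqr_ge0.
have -> : B *m B *m (B *m B) = horner_mx H (p ^+ 4).
  by rewrite rmorphXn /= !exprS expr0 mulr1 /B -!mulmxE !mulmxA.
have q4 j : (p ^+ 4).[r j] = r j.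
  by rewrite horner_exp pr (exprM _ 2 2) !sqr_sqrtr ?sqrtr_ge0 ?(rP j).2.
move: (p ^+ 4) q4 => q qE; apply: (map_mx_inj (f := f)).
rewrite map_horner_mx -/A; move: Aeq Punit rP.
move: A P d {Aherm dreal dE} => A P d Aeq Punit rP.
rewrite Aeq.
rewrite (horner_mx_uconjC (map_poly f q) (diag_mx d) Punit).
rewrite horner_mx_diag.
suff -> : map_mx (horner (map_poly f q)) d = d by [].
by apply/rowP => j; rewrite mxE (rP j).1 horner_map /= qE.
Qed.

(* The block matrix [A *; B D]; the diagonal blocks are meant to be symmetric. *)
Definition symblock_mx (R : realType) (m n : nat)
    (A : 'M[R]_m) (B : 'M[R]_(n, m)) (D : 'M[R]_n) : 'M[R]_(m + n) :=
  block_mx A B^T B D.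

(* In finite dimension, C^{k+1} is differentiability together with all
   directional derivatives being C^k. *)
Fixpoint Ck (R : realType) (V W : normedModType R) (k : nat) (f : V -> W) :
    Prop :=
  match k with
  | 0 => continuous f
  | k'.+1 => (forall x : V, differentiable f x) /\
             (forall v : V, Ck k' (fun x : V => 'D_v f x))
  end.

Definition smooth (R : realType) (V W : normedModType R) (f : V -> W) : Prop :=
  forall k : nat, Ck k f.

Definition partial_jacobian_a (R : realType) (nd na m : nat)
    (f : 'cV[R]_nd * 'cV[R]_na -> 'cV[R]_m)
    (xd : 'cV[R]_nd) (xa : 'cV[R]_na) : 'M[R]_(m, na) :=
  \matrix_(i < m, j < na)
    'D_(delta_mx j 0) (fun y : 'cV[R]_na => f (xd, y) i 0) xa.

(* Solutions of Ed xd' = Acl xd + Gd fd(xd, xa), 0 = Aa xa + Ga fa(xd, xa) on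
   [t0, +oo[ staying in the operating regions.  No derivative is required at t0
   itself, where the functions, defined on all of R, need not be two-sidedly
   differentiable. *)
Definition ndae_solution (R : realType) (nd na nfd nfa : nat)
    (Ed Acl : 'M[R]_nd) (Gd : 'M[R]_(nd, nfd))
    (Aa : 'M[R]_na) (Ga : 'M[R]_(na, nfa))
    (fd : 'cV[R]_nd * 'cV[R]_na -> 'cV[R]_nfd)
    (fa : 'cV[R]_nd * 'cV[R]_na -> 'cV[R]_nfa)
    (Xd : set 'cV[R]_nd) (Xa : set 'cV[R]_na)
    (t0 : R) (xd : R -> 'cV[R]_nd) (xa : R -> 'cV[R]_na) : Prop :=
  [/\ {within `[t0, +oo[, continuous xd},
      {within `[t0, +oo[, continuous xa},
      forall t : R, t0 <= t -> Xd (xd t) /\ Xa (xa t),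
      forall t : R, t0 < t -> derivable xd t 1 /\
        Ed *m derive1 xd t = Acl *m xd t + Gd *m fd (xd t, xa t) &
      forall t : R, t0 <= t -> 0 = Aa *m xa t + Ga *m fa (xd t, xa t)].

Definition asymptotically_stable (R : realType) (nd na nfd nfa : nat)
    (Ed Acl : 'M[R]_nd) (Gd : 'M[R]_(nd, nfd))
    (Aa : 'M[R]_na) (Ga : 'M[R]_(na, nfa))
    (fd : 'cV[R]_nd * 'cV[R]_na -> 'cV[R]_nfd)
    (fa : 'cV[R]_nd * 'cV[R]_na -> 'cV[R]_nfa)
    (Xd : set 'cV[R]_nd) (Xa : set 'cV[R]_na) : Prop :=
  forall (t0 : R) (xd : R -> 'cV[R]_nd) (xa : R -> 'cV[R]_na),
    ndae_solution Ed Acl Gd Aa Ga fd fa Xd Xa t0 xd xa ->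
    norm2 (xd t) @[t --> +oo] --> (0 : R) /\
    norm2 (xa t) @[t --> +oo] --> (0 : R).

(* The 4 x 4 block matrix, with block sizes nd, na, nd, na, of the LMI;
   Hd and Ha enter through their square roots. *)
Definition lmi_mx (R : realType) (nd na nu nfd nfa : nat)
    (Ed Ad : 'M[R]_nd) (Aa : 'M[R]_na)
    (Gd : 'M[R]_(nd, nfd)) (Ga : 'M[R]_(na, nfa)) (Bd : 'M[R]_(nd, nu))
    (Hd : 'M[R]_nd) (Ha : 'M[R]_na)
    (X1 : 'M[R]_nd) (X2 : 'M[R]_(na, nd)) (Rm : 'M[R]_na) (Y : 'M[R]_(na, nd))
    (W : 'M[R]_(nu, nd)) (eps : R) : 'M[R]_((nd + na) + (nd + na)) :=
  let Psi := Ed *m X1 *m Ad^T + Ad *m X1 *m Ed^T + Ed *m W^T *m Bd^T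
             + Bd *m W *m Ed^T + eps *: (Gd *m Gd^T) in
  let Theta := Rm^T *m Aa^T + Aa *m Rm + eps *: (Ga *m Ga^T) in
  symblock_mx
    (symblock_mx Psi (Aa *m X2 *m Ed^T + Aa *m Y) Theta)
    (block_mx (psd_sqrtmx Hd *m X1 *m Ed^T) 0
              (psd_sqrtmx Ha *m X2 *m Ed^T + psd_sqrtmx Ha *m Y)
              (psd_sqrtmx Ha *m Rm))
    (symblock_mx (- eps%:M) 0 (- eps%:M)).

(* Main.v *)
Require Import Defs.
From HB Require Import structures.
From mathcomp Require Import all_boot all_order all_algebra.
From mathcomp Require Import all_classical all_reals all_analysis.
From mathcomp Require Import ring lra.

Set Implicit Arguments.
Unset Strict Implicit.
Unset Printing Implicit Defensive.

Import Order.TTheory GRing.Theory Num.Theory.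
Import numFieldNormedType.Exports.

Local Open Scope ring_scope.
Local Open Scope classical_set_scope.

(* The LMI forces Ed and Rm to be invertible, so every state (xd, xa) is
   xd = X1 Ed^T a, xa = (X2 Ed^T + Y) a + Rm b for unique a and b.  The Lyapunov
   function is V = xd^T X1^-1 xd: along a solution V' = 2 a^T Ed xd', to which
   one adds 2 b^T (Aa xa + Ga fa) = 0.  Bounding the terms in fd and fa by
   Young's inequality and the growth bounds, and eliminating the last two block
   rows of the LMI, gives V' <= - k |a|^2 <= - k' V, so V and xd decay
   exponentially.  The same estimate with a = 0, b = Rm^-1 xa, xd = 0 and fd = 0
   (the algebraic equation alone) gives |xa|^2 <= C |xd|^2. *)

(** * Inner product, Young's inequality and bounds on quadratic forms *)

Definition dotv (R : realType) n (u v : 'cV[R]_n) : R := (u^T *m v) 0 0.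

Section DotProduct.
Variable R : realType.

Lemma dotvE n (u v : 'cV[R]_n) : dotv u v = \sum_i u i 0 * v i 0.
Proof. by rewrite /dotv mxE; apply: eq_bigr => i _; rewrite mxE. Qed.

Lemma dotvC n (u v : 'cV[R]_n) : dotv u v = dotv v u.
Proof. by rewrite !dotvE; apply: eq_bigr => i _; rewrite mulrC. Qed.

Lemma dotvDr n (u v w : 'cV[R]_n) : dotv u (v + w) = dotv u v + dotv u w.
Proof. by rewrite /dotv mulmxDr mxE. Qed.

Lemma dotvZr n a (u v : 'cV[R]_n) : dotv u (a *: v) = a * dotv u v.
Proof. by rewrite /dotv -scalemxAr mxE. Qed.

Lemma dotvNr n (u v : 'cV[R]_n) : dotv u (- v) = - dotv u v.
Proof. by rewrite -scaleN1r dotvZr mulN1r. Qed.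

Lemma dotv0r n (u : 'cV[R]_n) : dotv u 0 = 0.
Proof. by rewrite -(scale0r 0) dotvZr mul0r. Qed.

Lemma dotvDl n (u v w : 'cV[R]_n) : dotv (u + v) w = dotv u w + dotv v w.
Proof. by rewrite dotvC dotvDr !(dotvC w). Qed.

Lemma dotvZl n a (u v : 'cV[R]_n) : dotv (a *: u) v = a * dotv u v.
Proof. by rewrite dotvC dotvZr dotvC. Qed.

Lemma dotvNl n (u v : 'cV[R]_n) : dotv (- u) v = - dotv u v.
Proof. by rewrite dotvC dotvNr dotvC. Qed.

Lemma dotv0l n (u : 'cV[R]_n) : dotv 0 u = 0.
Proof. by rewrite dotvC dotv0r. Qed.

Lemma dotv_mulmxr m n (A : 'M[R]_(m, n)) u v :
  dotv u (A *m v) = dotv (A^T *m u) v.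
Proof. by rewrite /dotv trmx_mul trmxK mulmxA. Qed.

Lemma dotv_col m n (u1 u2 : 'cV[R]_m) (v1 v2 : 'cV[R]_n) :
  dotv (col_mx u1 v1) (col_mx u2 v2) = dotv u1 u2 + dotv v1 v2.
Proof. by rewrite /dotv tr_col_mx mul_row_col mxE. Qed.

Lemma dotv_ge0 n (u : 'cV[R]_n) : 0 <= dotv u u.
Proof. by rewrite dotvE; apply: sumr_ge0 => i _; rewrite -expr2 sqr_ge0. Qed.

Lemma dotv_eq0 n (u : 'cV[R]_n) : dotv u u = 0 -> u = 0.
Proof.
rewrite dotvE => /eqP; rewrite psumr_eq0; last by move=> i _; rewrite -expr2 sqr_ge0.
move/allP => u0; apply/colP => i; apply/eqP; rewrite mxE -sqrf_eq0 expr2.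
by apply: u0; rewrite mem_index_enum.
Qed.

Lemma sqr_norm2 n (u : 'cV[R]_n) : norm2 u ^+ 2 = dotv u u.
Proof.
rewrite sqr_sqrtr; last by apply: sumr_ge0 => i _; rewrite sqr_ge0.
by rewrite dotvE; apply: eq_bigr => i _; rewrite expr2.
Qed.

Lemma norm2E n (u : 'cV[R]_n) : norm2 u = Num.sqrt (dotv u u).
Proof. by rewrite -sqr_norm2 sqrtr_sqr ger0_norm // sqrtr_ge0. Qed.

(** Expand [|e u - v|^2 >= 0] and divide by [e]. *)
Lemma dotv_young n (u v : 'cV[R]_n) (e : R) : 0 < e ->
  2 * dotv u v <= e * dotv u u + e^-1 * dotv v v.
Proof.
move=> e0; have := dotv_ge0 (e *: u - v).
rewrite !(dotvDl, dotvDr, dotvNl, dotvNr, dotvZl, dotvZr) (dotvC v u) => h.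
rewrite -subr_ge0 -(pmulr_rge0 _ e0).
by rewrite mulrBr mulrDr mulrA mulVKf ?gt_eqF //; lra.
Qed.

Lemma quad_le n (A : 'M[R]_n) :
  exists2 C, 0 < C & forall u, dotv u (A *m u) <= C * dotv u u.
Proof.
(* The summand 1 keeps the constant positive even for [A = 0], since such constants are later
   divided by. *)
exists (1 + \sum_i \sum_j `|A i j|).
  by rewrite ltr_pwDl // sumr_ge0 // => i _; rewrite sumr_ge0.
move=> u; rewrite mulrDl mul1r.
apply: (@le_trans _ _ ((\sum_i \sum_j `|A i j|) * dotv u u)); last first.
  by rewrite lerDr dotv_ge0.
rewrite [dotv u _]dotvE mulr_suml; apply: ler_sum => i _.
rewrite mxE mulr_sumr mulr_suml; apply: ler_sum => j _.
have le_coord k : u k 0 ^+ 2 <= dotv u u.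
  rewrite dotvE (bigD1 k) //= -expr2 lerDl; apply: sumr_ge0 => l _.
  by rewrite -expr2 sqr_ge0.
rewrite mulrCA; apply: (le_trans (ler_norm _)); rewrite normrM ler_wpM2l //.
(* The two squares give [|u_i u_j| <= (u_i^2 + u_j^2) / 2], which is at most [dotv u u]. *)
have := sqr_ge0 (u i 0 - u j 0); have := sqr_ge0 (u i 0 + u j 0).
have := le_coord i; have := le_coord j; rewrite ler_norml.
by move: (dotv u u) (u i 0) (u j 0) => d x y *; apply/andP; split; nra.
Qed.

Lemma unitmx_inj n (A : 'M[R]_n) :
  (forall u : 'cV[R]_n, A *m u = 0 -> u = 0) -> A \in unitmx.
Proof.
move=> Ainj; rewrite -unitmx_tr -row_free_unit; apply: inj_row_free => v vA.
apply: trmx_inj; rewrite trmx0; apply: Ainj.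
by apply: trmx_inj; rewrite trmx_mul trmxK vA trmx0.
Qed.

Lemma posdefmx_possemidefmx n (A : 'M[R]_n) : posdefmx A -> possemidefmx A.
Proof.
move=> [Asym Apos]; split => // u; have [->|/Apos/ltW//] := eqVneq u 0.
by rewrite mulmx0 mxE.
Qed.

Lemma posdefmx_unit n (A : 'M[R]_n) : posdefmx A -> A \in unitmx.
Proof.
move=> [_ Apos]; apply: unitmx_inj => u Au; apply/eqP; apply/negPn/negP => /Apos.
by rewrite -mulmxA Au mulmx0 mxE ltxx.
Qed.

(* With S the square root of A, [dotv u (A *m u)] is the square norm of S u,
   and u = S^-1 (S u): the bound follows without a compactness argument. *)
Lemma posdefmx_coercive n (A : 'M[R]_n) : posdefmx A ->
  exists2 c, 0 < c & forall u, c * dotv u u <= dotv u (A *m u).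
Proof.
move=> Apos; have := psd_sqrtmxP (posdefmx_possemidefmx Apos).
move: (psd_sqrtmx A) => S [[Ssym _] SS].
have Sunit : S \in unitmx.
  by have := posdefmx_unit Apos; rewrite -SS unitmx_mul => /andP[].
have [C C0 CP] := quad_le ((invmx S)^T *m invmx S).
exists C^-1; first by rewrite invr_gt0.
move=> u; rewrite mulrC ler_pdivrMr // mulrC.
rewrite -SS -mulmxA dotv_mulmxr Ssym.
have := CP (S *m u); rewrite -mulmxA dotv_mulmxr trmxK.
by rewrite mulKmx.
Qed.

Lemma negdefmx_coercive n (A : 'M[R]_n) : negdefmx A ->
  exists2 c, 0 < c & forall u, dotv u (A *m u) <= - c * dotv u u.
Proof.
move=> [Asym Aneg]; have Npos : posdefmx (- A).
  split=> [|u /Aneg]; first by rewrite linearN /= Asym.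
  by move=> uA; rewrite mulmxN mulNmx mxE oppr_gt0.
have [c c0 cP] := posdefmx_coercive Npos; exists c => // u.
by have := cP u; rewrite mulNmx dotvNr; lra.
Qed.

Lemma gram_possemidefmx m n (A : 'M[R]_(m, n)) : possemidefmx (A^T *m A).
Proof.
split=> [|u]; first by rewrite trmx_mul trmxK.
by rewrite mulmxA -trmx_mul -mulmxA; exact: dotv_ge0.
Qed.

Lemma possemidefmxD n (A B : 'M[R]_n) :
  possemidefmx A -> possemidefmx B -> possemidefmx (A + B).
Proof.
move=> [As Ap] [Bs Bp]; split=> [|u]; first by rewrite linearD /= As Bs.
by rewrite mulmxDr mulmxDl mxE addr_ge0.
Qed.

Lemma quad_gram m n (A : 'M[R]_(m, n)) u :
  dotv u (A^T *m A *m u) = norm2 (A *m u) ^+ 2.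
Proof. by rewrite sqr_norm2 -mulmxA dotv_mulmxr trmxK. Qed.

Lemma quad_symblock m n (A : 'M[R]_m) (B : 'M[R]_(n, m)) (D : 'M[R]_n) u v :
  dotv (col_mx u v) (symblock_mx A B D *m col_mx u v) =
  dotv u (A *m u) + 2 * dotv v (B *m u) + dotv v (D *m v).
Proof.
rewrite /symblock_mx mul_block_col dotv_col !dotvDr.
rewrite [dotv u (B^T *m v)]dotv_mulmxr trmxK (dotvC (B *m u)); ring.
Qed.

End DotProduct.

(** * The dissipation inequality contained in the LMI *)

Section Dissipation.
Variables (R : realType) (nd na nu nfd nfa : nat).
Variables (Ed Ad : 'M[R]_nd) (Aa : 'M[R]_na).
Variables (Gd : 'M[R]_(nd, nfd)) (Ga : 'M[R]_(na, nfa)) (Bd : 'M[R]_(nd, nu)).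
Variables (Hd : 'M[R]_nd) (Ha : 'M[R]_na).
Variables (X1 : 'M[R]_nd) (X2 : 'M[R]_(na, nd)) (Rm : 'M[R]_na).
Variables (Y : 'M[R]_(na, nd)) (W : 'M[R]_(nu, nd)) (eps : R).
Hypotheses (Hd_ge0 : possemidefmx Hd) (Ha_ge0 : possemidefmx Ha).
Hypotheses (X1_sym : X1^T = X1) (eps_gt0 : 0 < eps).
Hypothesis lmi : negdefmx (lmi_mx Ed Ad Aa Gd Ga Bd Hd Ha X1 X2 Rm Y W eps).

(* Evaluates the LMI at (a, b, c, d) with c = Hd^(1/2) xd / eps and
   d = Ha^(1/2) xa / eps, which maximizes the form in (c, d). *)
Lemma lmi_dissipation : exists2 k, 0 < k &
  forall a b phi psi xd xa,
    xd = X1 *m (Ed^T *m a) ->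
    xa = X2 *m (Ed^T *m a) + Y *m a + Rm *m b ->
    2 * dotv a (Ad *m xd + Bd *m (W *m (Ed^T *m a)) + Gd *m phi)
      + 2 * dotv b (Aa *m xa + Ga *m psi) <=
    - k * (dotv a a + dotv b b)
      + eps^-1 * (dotv phi phi + dotv psi psi
                  - dotv xd (Hd *m xd) - dotv xa (Ha *m xa)).
Proof.
have [k k0 kP] := negdefmx_coercive lmi; exists k => // a b phi psi xd xa xdE xaE.
have [[Sds _] SdE] := psd_sqrtmxP Hd_ge0; have [[Sas _] SaE] := psd_sqrtmxP Ha_ge0.
have [c cE] : exists c, c = eps^-1 *: (psd_sqrtmx Hd *m xd) by eexists.
have [d dE] : exists d, d = eps^-1 *: (psd_sqrtmx Ha *m xa) by eexists.
have := kP (col_mx (col_mx a b) (col_mx c d)); rewrite /lmi_mx.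
move: (psd_sqrtmx Hd) (psd_sqrtmx Ha) Sds SdE Sas SaE cE dE => Sd Sa Sds SdE Sas SaE cE dE.
rewrite !quad_symblock mul_block_col !dotv_col.
have -> : Sd *m X1 *m Ed^T *m a + 0 *m b = Sd *m xd.
  by rewrite mul0mx addr0 xdE !mulmxA.
have -> : (Sa *m X2 *m Ed^T + Sa *m Y) *m a + Sa *m Rm *m b = Sa *m xa.
  by rewrite xaE !mulmxDr mulmxDl !mulmxA.
rewrite !mulNmx !mul_scalar_mx mul0mx !dotvNr !dotvZr dotv0r.
(* The cross terms count twice and the diagonal terms once, negatively, so [c] and [d] leave
   [eps^-1] times the forms of [Hd] at [xd] and [Ha] at [xa]. *)
have -> : dotv c (Sd *m xd) = eps^-1 * dotv xd (Hd *m xd).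
  by rewrite cE dotvZl -SdE -mulmxA [in RHS]dotv_mulmxr Sds.
have -> : dotv d (Sa *m xa) = eps^-1 * dotv xa (Ha *m xa).
  by rewrite dE dotvZl -SaE -mulmxA [in RHS]dotv_mulmxr Sas.
have -> : eps * dotv c c = eps^-1 * dotv xd (Hd *m xd).
  by rewrite cE dotvZl dotvZr mulVKf ?gt_eqF // -SdE -mulmxA [in RHS]dotv_mulmxr Sds.
have -> : eps * dotv d d = eps^-1 * dotv xa (Ha *m xa).
  by rewrite dE dotvZl dotvZr mulVKf ?gt_eqF // -SaE -mulmxA [in RHS]dotv_mulmxr Sas.
have -> : dotv a ((Ed *m X1 *m Ad^T + Ad *m X1 *m Ed^T + Ed *m W^T *m Bd^T
    + Bd *m W *m Ed^T + eps *: (Gd *m Gd^T)) *m a) =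
    2 * dotv a (Ad *m xd + Bd *m (W *m (Ed^T *m a)))
    + eps * dotv (Gd^T *m a) (Gd^T *m a).
  (* A matrix and its transpose have the same quadratic form, so the terms of Psi other than
     [eps *: (Gd *m Gd^T)] merge in pairs. *)
  have EAE : dotv a (Ed *m X1 *m Ad^T *m a) = dotv a (Ad *m xd).
    by rewrite dotv_mulmxr !trmx_mul !trmxK X1_sym dotvC xdE !mulmxA.
  have EBE : dotv a (Ed *m W^T *m Bd^T *m a) = dotv a (Bd *m (W *m (Ed^T *m a))).
    by rewrite !mulmxA dotv_mulmxr !(trmx_mul, trmxK) dotvC !mulmxA.
  rewrite !mulmxDl !dotvDr EAE EBE -scalemxAl dotvZr -[Gd *m Gd^T *m a]mulmxA.
  by rewrite [dotv a (Gd *m _)]dotv_mulmxr xdE !mulmxA; ring.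
have -> : dotv b ((Rm^T *m Aa^T + Aa *m Rm + eps *: (Ga *m Ga^T)) *m b) =
    2 * dotv b (Aa *m (Rm *m b)) + eps * dotv (Ga^T *m b) (Ga^T *m b).
  have RAR : dotv b (Rm^T *m Aa^T *m b) = dotv b (Aa *m (Rm *m b)).
    by rewrite dotv_mulmxr !(trmx_mul, trmxK) dotvC mulmxA.
  rewrite !mulmxDl !dotvDr RAR -scalemxAl dotvZr -[Ga *m Ga^T *m b]mulmxA.
  by rewrite [dotv b (Ga *m _)]dotv_mulmxr !mulmxA; ring.
(* The (2,1) block and Theta together reassemble [Aa *m xa]. *)
have AaE : dotv b (Aa *m xa) =
    dotv b ((Aa *m X2 *m Ed^T + Aa *m Y) *m a) + dotv b (Aa *m (Rm *m b)).
  by rewrite xaE !mulmxDr !mulmxDl !dotvDr !mulmxA.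
(* With weight [eps], the squares of [Gd^T a] and [Ga^T b] are exactly those supplied by Psi and
   Theta; [eps^-1] is left on [phi] and [psi]. *)
have := dotv_young (Gd^T *m a) phi eps_gt0.
have := dotv_young (Ga^T *m b) psi eps_gt0.
rewrite !dotvDr AaE -!dotv_mulmxr !(mulrDr, mulrBr, mulrN).
have := mulr_ge0 (ltW k0) (dotv_ge0 c); have := mulr_ge0 (ltW k0) (dotv_ge0 d).
lra.
Qed.

(** If [Ed^T a = 0], the dissipation inequality with [b], [phi], [psi] and [xd] zero and [xa = Y a]
    has left side 0, which forces [k |a|^2 <= 0]. *)
Lemma lmi_unit_trEd : Ed^T \in unitmx.
Proof.
have [k k0 kP] := lmi_dissipation; apply: unitmx_inj => a Ea.
have eps_inv : 0 < eps^-1 by rewrite invr_gt0.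
apply: dotv_eq0; apply/eqP; rewrite eq_le dotv_ge0 andbT -(pmulr_rle0 _ k0).
have := kP a 0 0 0 0 (Y *m a); rewrite Ea !mulmx0 add0r !addr0 !dotv0r dotv0l.
move=> /(_ erefl erefl); have := Ha_ge0.2 (Y *m a).
rewrite -mulmxA -/(dotv _ _) => /(mulr_ge0 (ltW eps_inv)).
by rewrite !(mulrDr, mulrN); lra.
Qed.

(** If [Rm b = 0], the choice [a = 0] makes both states vanish, and the dissipation inequality
    reduces to [k |b|^2 <= 0]. *)
Lemma lmi_unit_Rm : Rm \in unitmx.
Proof.
have [k k0 kP] := lmi_dissipation; apply: unitmx_inj => b Rb.
apply: dotv_eq0; apply/eqP; rewrite eq_le dotv_ge0 andbT -(pmulr_rle0 _ k0).
have := kP 0 b 0 0 0 0; rewrite Rb !mulmx0 !addr0 !dotv0r.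
by move=> /(_ erefl erefl); lra.
Qed.

End Dissipation.

(** * Derivatives along trajectories and exponential decay *)

Section Derivatives.
Variable R : realType.

Lemma is_derive_coord n (u : R -> 'cV[R]_n) (t : R) i :
  derivable u t 1 -> is_derive t 1 (fun s => u s i 0) (derive1 u t i 0).
Proof.
move=> ut; rewrite derive1E derive_mx // mxE.
by apply: derivableP; exact: (derivable_mxP u t 1).1.
Qed.

Lemma is_derive_mulmx m n (A : 'M[R]_(m, n)) (u : R -> 'cV[R]_n) (du : 'cV[R]_n)
    (t : R) :
  (forall i, is_derive t 1 (fun s => u s i 0) (du i 0)) ->
  forall i, is_derive t 1 (fun s => (A *m u s) i 0) ((A *m du) i 0).
Proof.
move=> ut i; rewrite mxE.
have -> : (fun s => (A *m u s) i 0) = \sum_j (A i j \*: (fun s => u s j 0)).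
  by apply/funext => s; rewrite mxE fct_sumE.
exact: is_derive_sum.
Qed.

Lemma is_derive_dotv n (u v : R -> 'cV[R]_n) (du dv : 'cV[R]_n) (t : R) :
  (forall i, is_derive t 1 (fun s => u s i 0) (du i 0)) ->
  (forall i, is_derive t 1 (fun s => v s i 0) (dv i 0)) ->
  is_derive t 1 (fun s => dotv (u s) (v s)) (dotv (u t) dv + dotv du (v t)).
Proof.
move=> ut vt; rewrite !dotvE -big_split /=.
have -> : (fun s => dotv (u s) (v s)) =
    \sum_i ((fun s => u s i 0) * (fun s => v s i 0)).
  by apply/funext => s; rewrite dotvE fct_sumE.
apply: is_derive_sum => i; apply: is_derive_eq.
by rewrite /= [in RHS](mulrC (du i 0)).
Qed.

(** Gronwall's argument: [V t * expR (k * t)] has nonpositive derivative, so [V] lies between 0 and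
    a multiple of [expR (- (k * t))]. *)
Lemma exp_decay_cvg0 (V dV : R -> R) (t1 k : R) : 0 < k ->
  (forall t, t1 <= t -> is_derive t 1 V (dV t)) ->
  (forall t, t1 <= t -> 0 <= V t) ->
  (forall t, t1 <= t -> dV t <= - k * V t) ->
  V t @[t --> +oo] --> (0 : R).
Proof.
move=> k0 VP V_ge0 dV_le.
pose g t := V t * expR (k * t).
have gP t : t1 <= t -> is_derive t 1 g (expR (k * t) * (dV t + k * V t)).
  move=> tt; have ? := VP t tt.
  have ? : is_derive t 1 (fun s : R => k * s) k.
    by apply: is_derive_eq; rewrite [_ *: _]mulr1.
  by apply: is_derive_eq; rewrite /GRing.scale /=; ring.
have g_le t : t1 <= t -> V t <= g t1 * expR (- (k * t)).
  move=> tt; rewrite expRN ler_pdivlMr ?expR_gt0 // -/(g t).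
  apply: (@ler0_derive1_le_cc _ g t1 t) => //; rewrite ?in_itv /= ?lexx ?tt //.
  - move=> s; rewrite in_itv /= => /andP[/ltW ts _].
    by have ? := gP s ts; exact: ex_derive.
  - move=> s; rewrite in_itv /= => /andP[/ltW ts _]; have ? := gP s ts.
    rewrite derive1E derive_val pmulr_rle0 ?expR_gt0 //.
    by have := dV_le s ts; lra.
  - apply: derivable_within_continuous => s; rewrite in_itv /= => /andP[ts _].
    by have ? := gP s ts; exact: ex_derive.
apply: (@squeeze_cvgr _ _ _ _ (cst 0) (fun t => g t1 * expR (- (k * t)))).
- by near=> t; rewrite V_ge0 ?g_le //; near: t; exact: nbhs_pinfty_ge.
- exact: cvg_cst.
- rewrite -(mulr0 (g t1)); apply: cvgMl_tmp.
  apply: (@cvg_comp _ _ _ (fun t => k * t) (fun t => expR (- t)) _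
    (pinfty_nbhs R)); last exact: cvgr_expR.
  exact: gt0_cvgMry.
Unshelve. all: by end_near. Qed.

Lemma norm2_cvg0 n (u : R -> 'cV[R]_n) (V : R -> R) (C t1 : R) :
  V t @[t --> +oo] --> (0 : R) ->
  (forall t, t1 <= t -> dotv (u t) (u t) <= C * V t) ->
  norm2 (u t) @[t --> +oo] --> (0 : R).
Proof.
move=> V0 u_le; under eq_fun do rewrite norm2E.
suff u0 : dotv (u t) (u t) @[t --> +oo] --> (0 : R).
  by rewrite -(sqrtr0 R); apply: continuous_cvg u0; exact: sqrt_continuous.
apply: (@squeeze_cvgr _ _ _ _ (cst 0) (fun t => C * V t)).
- by near=> t; rewrite dotv_ge0 u_le //; near: t; exact: nbhs_pinfty_ge.
- exact: cvg_cst.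
- by rewrite -(mulr0 C); apply: cvgMl_tmp.
Unshelve. all: by end_near. Qed.

End Derivatives.

(** * Lyapunov decay of [xd], then control of [xa] by [xd] *)

Theorem proposition1 (R : realType) (nd na nu nfd nfa : nat)
    (Ed Ad : 'M[R]_nd) (Aa : 'M[R]_na)
    (Gd : 'M[R]_(nd, nfd)) (Ga : 'M[R]_(na, nfa)) (Bd : 'M[R]_(nd, nu))
    (fd : 'cV[R]_nd * 'cV[R]_na -> 'cV[R]_nfd)
    (fa : 'cV[R]_nd * 'cV[R]_na -> 'cV[R]_nfa)
    (Xd : set 'cV[R]_nd) (Xa : set 'cV[R]_na)
    (p1 p2 p3 p4 : nat)
    (Hdd : 'M[R]_(p1, nd)) (Had : 'M[R]_(p2, na))
    (Hda : 'M[R]_(p3, nd)) (Haa : 'M[R]_(p4, na))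
    (fd_smooth : smooth fd) (fa_smooth : smooth fa)
    (fd0 : fd (0, 0) = 0) (fa0 : fa (0, 0) = 0)
    (fd_bound : forall (xd : 'cV[R]_nd) (xa : 'cV[R]_na), Xd xd -> Xa xa ->
      norm2 (fd (xd, xa)) ^+ 2 <= norm2 (Hdd *m xd) ^+ 2 + norm2 (Had *m xa) ^+ 2)
    (fa_bound : forall (xd : 'cV[R]_nd) (xa : 'cV[R]_na), Xd xd -> Xa xa ->
      norm2 (fa (xd, xa)) ^+ 2 <= norm2 (Hda *m xd) ^+ 2 + norm2 (Haa *m xa) ^+ 2)
    (index_one : forall (xd : 'cV[R]_nd) (xa : 'cV[R]_na), Xd xd -> Xa xa ->
      \rank (Aa + Ga *m partial_jacobian_a fa xd xa)%R = na)
    (X1 : 'M[R]_nd) (X2 : 'M[R]_(na, nd)) (Rm : 'M[R]_na) (Y : 'M[R]_(na, nd))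
    (W : 'M[R]_(nu, nd)) (eps : R)
    (X1_posdef : posdefmx X1) (eps_gt0 : 0 < eps)
    (lmi : negdefmx (lmi_mx Ed Ad Aa Gd Ga Bd
      (Hdd^T *m Hdd + Hda^T *m Hda) (Had^T *m Had + Haa^T *m Haa)
      X1 X2 Rm Y W eps)) :
  let Kd := W *m invmx X1 in
  asymptotically_stable Ed (Ad + Bd *m Kd) Gd Aa Ga fd fa Xd Xa.
Proof.
move=> Kd t0 xd xa [_ _ inX ode alg].
have Hd_ge0 := possemidefmxD (gram_possemidefmx Hdd) (gram_possemidefmx Hda).
have Ha_ge0 := possemidefmxD (gram_possemidefmx Had) (gram_possemidefmx Haa).
have X1_sym := X1_posdef.1; have X1_unit := posdefmx_unit X1_posdef.
have [k k0 kP] := lmi_dissipation Hd_ge0 Ha_ge0 X1_sym eps_gt0 lmi.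
have Ed_unit := lmi_unit_trEd Hd_ge0 Ha_ge0 X1_sym eps_gt0 lmi.
have Rm_unit := lmi_unit_Rm Hd_ge0 Ha_ge0 X1_sym eps_gt0 lmi.
have eps_inv : 0 < eps^-1 by rewrite invr_gt0.
pose w t := invmx X1 *m xd t.
pose a t := invmx Ed^T *m w t.
pose b t := invmx Rm *m (xa t - X2 *m (Ed^T *m a t) - Y *m a t).
pose V t := dotv (w t) (xd t).
have Ea t : Ed^T *m a t = w t by rewrite mulKVmx.
have xdE t : xd t = X1 *m (Ed^T *m a t) by rewrite Ea mulKVmx.
have xaE t : xa t = X2 *m (Ed^T *m a t) + Y *m a t + Rm *m b t.
  by rewrite [Rm *m _]mulKVmx // -[xa t - _ - _]addrA -opprD [RHS]addrC subrK.
(* The forms of [Hd] and [Ha] add up to the sum of the two growth bounds, so the bracket multiplied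
   by [eps^-1] in the dissipation inequality is nonpositive. *)
have quadH t : dotv (xd t) ((Hdd^T *m Hdd + Hda^T *m Hda) *m xd t)
    + dotv (xa t) ((Had^T *m Had + Haa^T *m Haa) *m xa t)
  = (norm2 (Hdd *m xd t) ^+ 2 + norm2 (Had *m xa t) ^+ 2)
    + (norm2 (Hda *m xd t) ^+ 2 + norm2 (Haa *m xa t) ^+ 2).
  by rewrite !mulmxDl !dotvDr !quad_gram; ring.
pose dV t := 2 * dotv (w t) (derive1 xd t).
have VP t : t0 < t -> is_derive t 1 V (dV t).
  move=> /ode[xdt _]; rewrite /V /dV /w.
  have dxd i := is_derive_coord i xdt.
  have := is_derive_dotv (is_derive_mulmx (invmx X1) dxd) dxd.
  (* As [X1^-1] is symmetric, both terms of the product rule equal [w . xd']. *)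
  rewrite (dotvC (_ *m derive1 xd t)) dotv_mulmxr trmx_inv X1_sym.
  by rewrite mulr2n mulrDl mul1r.
have dV_le t : t0 < t -> dV t <= - k * dotv (a t) (a t).
  move=> tt; have [_ eqd] := ode t tt; have [Xdt Xat] := inX t (ltW tt).
  have := fd_bound _ _ Xdt Xat; have := fa_bound _ _ Xdt Xat.
  have := kP _ _ (fd (xd t, xa t)) (fa (xd t, xa t)) _ _ (xdE t) (xaE t).
  (* The algebraic equation removes the [b] term. The choice of gain gives [W Ed^T a = Kd xd], so
     the rest is [2 a . Ed xd' = 2 w . xd'], that is [dV]. *)
  rewrite -(alg t (ltW tt)) dotv0r mulr0 addr0.
  have -> : W *m (Ed^T *m a t) = Kd *m xd t by rewrite Ea /Kd -mulmxA.
  rewrite [Bd *m _]mulmxA -mulmxDl -eqd dotv_mulmxr Ea -/(dV t).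
  move=> dV_le fa_le fd_le; apply: (le_trans dV_le).
  rewrite mulrDr -addrA gerDl -[leRHS]addr0 lerD //.
    by rewrite mulNr oppr_le0 mulr_ge0 ?(ltW k0) ?dotv_ge0.
  by rewrite pmulr_rle0 // -!sqr_norm2; have := quadH t; lra.
have [c1 c1_gt0 c1P] := posdefmx_coercive X1_posdef.
have [C1 C1_gt0 C1P] := quad_le X1.
have [C2 C2_gt0 C2P] := quad_le (Ed *m Ed^T).
have [C3 C3_gt0 C3P] := quad_le (X1 *m X1).
have [C4 C4_gt0 C4P] := quad_le (Rm^T *m Rm).
have [C5 C5_gt0 C5P] := quad_le (Hda^T *m Hda).
have VE t : V t = dotv (w t) (X1 *m w t) by rewrite /V xdE Ea.
have w_le t : dotv (w t) (w t) <= c1^-1 * V t.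
  by rewrite ler_pdivlMl // VE.
have w_ge t : dotv (w t) (w t) <= C2 * dotv (a t) (a t).
  by have := C2P (a t); rewrite -mulmxA dotv_mulmxr Ea.
have xd_le t : dotv (xd t) (xd t) <= C3 / c1 * V t.
  rewrite -mulrA (le_trans _ (ler_wpM2l (ltW C3_gt0) (w_le t))) //.
  by have := C3P (w t); rewrite -mulmxA dotv_mulmxr X1_sym mulKVmx.
have V_cvg0 : V t @[t --> +oo] --> (0 : R).
  (* The rate comes from [V <= C1 |w|^2 <= C1 C2 |a|^2]. *)
  have k'_gt0 : 0 < k / (C1 * C2) by rewrite divr_gt0 // mulr_gt0.
  (* Starting at [t0 + 1] avoids [t0], where [xd] need not be differentiable. *)
  apply: (exp_decay_cvg0 (t1 := t0 + 1) (dV := dV) k'_gt0) => t tt.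
  - by apply: VP; lra.
  - have := le_trans (dotv_ge0 _) (w_le t).
    by rewrite pmulr_rge0 // invr_gt0.
  - apply: (le_trans (dV_le t _)); first lra.
    rewrite !mulNr lerN2 -mulrA ler_wpM2l ?(ltW k0) //.
    rewrite ler_pdivrMl ?mulr_gt0 // VE -mulrA.
    exact: (le_trans (C1P _) (ler_wpM2l (ltW C1_gt0) (w_ge t))).
split; first exact: norm2_cvg0 V_cvg0 (fun t (_ : t0 <= t) => xd_le t).
(* The factors come in turn from [xa = Rm b0], the dissipation bound on [b0] ([k^-1] and [eps^-1]),
   the form of [Hda], and [|xd|^2 <= C3 / c1 * V]. *)
apply: (norm2_cvg0 V_cvg0 (t1 := t0)
  (C := C4 * (k^-1 * (eps^-1 * (C5 * (C3 / c1)))))) => t tt.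
have [Xdt Xat] := inX t tt; have fa_le := fa_bound _ _ Xdt Xat.
pose b0 := invmx Rm *m xa t.
have b0_le : k * dotv b0 b0 <= eps^-1 * norm2 (Hda *m xd t) ^+ 2.
  have xd0 : 0 = X1 *m (Ed^T *m (0 : 'cV_nd)) by rewrite !mulmx0.
  have xa0 : xa t = X2 *m (Ed^T *m 0) + Y *m 0 + Rm *m b0.
    by rewrite !mulmx0 !add0r mulKVmx.
  have := kP _ _ 0 (fa (xd t, xa t)) _ _ xd0 xa0.
  rewrite !mulmx0 !addr0 -(alg t tt) !dotv0r mulmxDl dotvDr !quad_gram.
  rewrite -!sqr_norm2 => diss.
  (* The growth bound is taken at the true [xd]. Its [Haa] term cancels against the form of [Ha],
     whose [Had] term has a favourable sign, so only [Hda xd] remains. *)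
  have := ler_wpM2l (ltW eps_inv) fa_le.
  have := mulr_ge0 (ltW eps_inv) (sqr_ge0 (norm2 (Had *m xa t))).
  move: diss; rewrite !(mulrDr, mulrN, mulNr); lra.
have Hda_le := C5P (xd t); rewrite quad_gram in Hda_le.
have := C4P b0; rewrite quad_gram mulKVmx // sqr_norm2 => xa_le.
rewrite -!mulrA (le_trans xa_le) // ler_wpM2l ?(ltW C4_gt0) //.
rewrite ler_pdivlMl // (le_trans b0_le) // ler_wpM2l ?(ltW eps_inv) //.
by rewrite (le_trans Hda_le) // ler_wpM2l ?(ltW C5_gt0) // mulrA.
Qed.
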